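(* Let $N\ge 2$, $p\ge 2$, $0<r_0<R_0\le\infty$, $\Omega=B]r_0,R_0[$, and let $V\in C(\Omega)$ with $V\ge 0$. Assume that there exists a positive radial strictly monotone increasing $C^2$ strict supersolution of $-\Delta_p w-V|w|^{p-2}w=0$ in $\Omega$. Let $u$ be a radial monotone increasing $C^2$-subsolution of this equation with $u(r_0)\ge 0$. Then at least one of the following alternatives occurs: (i) for every positive radial strictly monotone increasing $C^2$ strict supersolution $v$ of the equation, there exists $C>0$ such that $u(r)\le C\,v(r)$ for all $r\in[r_0,R_0[$; (ii) for every positive (not necessarily radial or increasing) $C^2$-supersolution $w$ of the equation, $u$ is not smaller than $w$, i.e. $$\limsup_{|x|\to R_0}\frac{u(x)}{w(x)}>0.$$
   Context: $\Delta_p w=\nabla\cdot(|\nabla w|^{p-2}\nabla w)$. For $0<r_0<R_0\le\infty$, $B]r_0,R_0[=\{x\in\mathbb{R}^N: r_0<|x|<R_0\}$ and $B[r_0,R_0[=\{x: r_0\le|x|<R_0\}$. A $C^2$-subsolution (resp. supersolution) in $\Omega=B]r_0,R_0[$ is a function $w\in C^2(B[r_0,R_0[)$ with $-\Delta_p w-V|w|^{p-2}w\le 0$ (resp. $\ge 0$) pointwise in $\Omega$; a strict supersolution satisfies $-\Delta_p w-V|w|^{p-2}w>0$ at every point of $\Omega$. A radial function $w(x)=\phi(|x|)$ is identified with $\phi$, with $w'(r)=\phi'(r)$; it is monotone increasing if $w'(r)\ge 0$ and strictly monotone increasing if $w'(r)>0$ for all $r\in[r_0,R_0[$. *)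

(* Defs.v *)
From HB Require Import structures.
From mathcomp Require Import all_boot all_order all_algebra.
From mathcomp Require Import all_classical all_reals all_analysis.
Set Implicit Arguments. Unset Strict Implicit. Unset Printing Implicit Defensive.
Import Order.TTheory GRing.Theory Num.Theory.
Import numFieldNormedType.Exports.
Local Open Scope classical_set_scope.
Local Open Scope ring_scope.

Section Defs.
Variables (R : realType) (N : nat).
Local Notation E := 'rV[R]_N.

Definition enorm (x : E) : R := Num.sqrt (\sum_(i < N) x ord0 i ^+ 2).

Definition evec (i : 'I_N) : E := delta_mx ord0 i.
Definition partial (i : 'I_N) (f : E -> R) (x : E) : R := derive f x (evec i).

Definition grad (f : E -> R) (x : E) : E := \row_(i < N) partial i f x.
Definition plap (p : R) (f : E -> R) (x : E) : R :=
  \sum_(i < N) partial i (fun y => enorm (grad f y) `^ (p - 2) * partial i f y) x.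

Definition Lop (p : R) (V : E -> R) (w : E -> R) (x : E) : R :=
  - plap p w x - V x * (`|w x| `^ (p - 2) * w x).

Definition Bopen (r0 : R) (R0 : \bar R) : set E :=
  [set x | r0 < enorm x /\ ((enorm x)%:E < R0)%E].
Definition Bclosed (r0 : R) (R0 : \bar R) : set E :=
  [set x | r0 <= enorm x /\ ((enorm x)%:E < R0)%E].

Definition C2_on (U : set E) (f : E -> R) : Prop :=
  forall x, U x ->
    [/\ differentiable f x,
        (forall i, differentiable (partial i f) x) &
        (forall i j, {for x, continuous (partial j (partial i f))})].

Definition C2 (r0 : R) (R0 : \bar R) (f : E -> R) : Prop :=
  exists U : set E, [/\ open U, Bclosed r0 R0 `<=` U & C2_on U f].

Definition subsolution p V r0 R0 (w : E -> R) : Prop :=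
  C2 r0 R0 w /\ forall x, Bopen r0 R0 x -> Lop p V w x <= 0.
Definition supersolution p V r0 R0 (w : E -> R) : Prop :=
  C2 r0 R0 w /\ forall x, Bopen r0 R0 x -> 0 <= Lop p V w x.
Definition strict_supersolution p V r0 R0 (w : E -> R) : Prop :=
  C2 r0 R0 w /\ forall x, Bopen r0 R0 x -> 0 < Lop p V w x.

Definition radial r0 R0 (w : E -> R) : Prop :=
  exists phi : R -> R, forall x, Bclosed r0 R0 x -> w x = phi (enorm x).

Definition rad_deriv (w : E -> R) (x : E) : R := derive w x ((enorm x)^-1 *: x).

Definition mono_inc r0 R0 (w : E -> R) : Prop :=
  forall x, Bclosed r0 R0 x -> 0 <= rad_deriv w x.
Definition strict_mono_inc r0 R0 (w : E -> R) : Prop :=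
  forall x, Bclosed r0 R0 x -> 0 < rad_deriv w x.

Definition positive r0 R0 (w : E -> R) : Prop :=
  forall x, Bclosed r0 R0 x -> 0 < w x.

Definition limsup_R0 r0 (R0 : \bar R) (f : E -> R) : \bar R :=
  ereal_inf [set ereal_sup [set (f x)%:E | x in Bopen rho R0]
            | rho in [set rho : R | r0 < rho /\ (rho%:E < R0)%E]].
End Defs.

(* Main.v *)
(** Suppose that [u / v] is unbounded for some [v] and that [u / w] tends to 0
    for some [w].  Choose [tau] such that [g = u - tau v] is negative on the
    inner sphere and positive somewhere, and, for a small [delta], maximize
    [(g y + delta (|x|^2 - |y|^2)) / w x] over [r0 <= |y| <= |x| <= rho].  For
    [rho] close to [R0] the maximum, say [M], is positive and is attained with
    [r0 < |x| < rho].
    - If [|y| < |x|], then [M w] is touched from below at [x] by a paraboloid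
      [c + delta |.|^2], whose p-Laplacian is positive, although [w] is a
      supersolution and [V >= 0].
    - If [|y| = |x|], then [M w] is touched from below at [x] by [g], whose
      radial slope at [x] is at least [2 delta |x| > 0].
    At such a point all gradients are positive multiples of the same unit vector
    [e], so that each p-Laplacian is a power of the slope times the linear
    operator [Delta + (p-2) D^2_ee]; the inequalities for [u], [v], [w] then
    contradict the convexity of [a^(p-1) / alpha^(p-2)]. *)

Require Import Defs.
From HB Require Import structures.
From mathcomp Require Import all_boot all_order all_algebra.
From mathcomp Require Import all_classical all_reals all_analysis.
From mathcomp Require Import ring lra.
Import Order.TTheory GRing.Theory Num.Theory.
Import numFieldNormedType.Exports.
Local Open Scope classical_set_scope.
Local Open Scope ring_scope.

(** * Directional derivatives as derivatives along lines *)

Section Lines.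
Context {R : realType} {E : normedModType R}.
Implicit Types (f : E -> R) (x v : E).

Lemma line_cvg0 x v : (t *: v + x) @[t --> (0 : R)] --> x.
Proof.
rewrite -[X in _ --> X](add0r x) -[X in _ --> X + _](scale0r v).
by apply: cvgD; [exact: cvgZl | exact: cvg_cst].
Qed.

Lemma is_derive_line f x v (t d : R) :
  is_derive (t *: v + x) v f d ->
  is_derive t 1 (fun s : R => f (s *: v + x)) d.
Proof.
have E1 : (fun h : R =>
      h^-1 *: (f ((h *: (1 : R^o) + t : R) *: v + x) - f (t *: v + x))) =
    (fun h : R => h^-1 *: (f (h *: v + (t *: v + x)) - f (t *: v + x))).
  by apply/funext => h; rewrite [_%:A]mulr1 scalerDl addrA.
by move=> [df dE]; apply: DeriveDef; rewrite ?/derivable ?/derive E1.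
Qed.

Lemma is_derive_line0 f x v (d : R) :
  is_derive (0 : R) 1 (fun s : R => f (s *: v + x)) d -> is_derive x v f d.
Proof.
have E1 : (fun h : R =>
      h^-1 *: (f ((h *: (1 : R^o) + 0 : R) *: v + x) - f (0 *: v + x))) =
    (fun h : R => h^-1 *: (f (h *: v + x) - f x)).
  by apply/funext => h; rewrite [_%:A]mulr1 addr0 scale0r add0r.
by move=> [df dE]; apply: DeriveDef; rewrite ?/derivable ?/derive -E1.
Qed.

(** Restricting to the line through [x] along [v] reduces this to the one-variable chain rule. *)
Lemma is_derive_chain (phi : R -> R) f x v (a b : R) :
  is_derive (f x) 1 phi a -> is_derive x v f b ->
  is_derive x v (fun y => phi (f y)) (a * b).
Proof.
move=> dphi df; apply: is_derive_line0.
apply: (@is_derive1_comp _ phi (fun s : R => f (s *: v + x))).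
  by rewrite scale0r add0r.
by apply: is_derive_line; rewrite scale0r add0r.
Qed.

End Lines.

(** * Second-order jets at 0 and the maximum test *)

Section Jets.
Context {R : realType}.
Implicit Types (F G : R -> R) (a b : R).

(** The second derivative is asked for at 0 alone, as the derivative of a witness [F'] for the
    first; this is what [C2] gives along a line and what the maximum test consumes. *)
Definition jet2 F a b := exists F' : R -> R,
  [/\ \forall t \near (0 : R), is_derive (t : R) 1 F (F' t), F' 0 = a
    & is_derive (0 : R) 1 F' b].

Lemma jet2D F G a b c d : jet2 F a b -> jet2 G c d ->
  jet2 (fun t => F t + G t) (a + c) (b + d).
Proof.
move=> [F' [dF F0 ddF]] [G' [dG G0 ddG]].
exists (fun t => F' t + G' t); split; last exact: is_deriveD.
- by near=> t; apply: is_deriveD; near: t.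
- by rewrite F0 G0.
Unshelve. all: by end_near. Qed.

Lemma jet2Z k F a b : jet2 F a b -> jet2 (fun t => k * F t) (k * a) (k * b).
Proof.
move=> [F' [dF F0 ddF]].
exists (fun t => k * F' t); split; last exact: is_deriveZ.
- by near=> t; apply: is_deriveZ; near: t.
- by rewrite F0.
Unshelve. all: by end_near. Qed.

Lemma jet2_cst c : jet2 (fun=> c) 0 0.
Proof.
by exists (cst 0); split=> //; [near=> t|]; exact: is_derive_cst.
Unshelve. all: by end_near. Qed.

Lemma jet2_sqr : jet2 (fun t => t ^+ 2) 0 2.
Proof.
exists (fun t => t + t); split; last 2 first.
- by rewrite addr0.
- exact: (is_deriveD (is_derive_id _ _) (is_derive_id _ _)).
near=> t; have := is_deriveM (is_derive_id t (1 : R)) (is_derive_id t (1 : R)).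
by rewrite /GRing.scale/= mulr1.
Unshelve. all: by end_near. Qed.

Lemma jet2_id : jet2 id 1 0.
Proof.
exists (cst 1); split=> //; last exact: is_derive_cst.
by near=> t; exact: is_derive_id.
Unshelve. all: by end_near. Qed.

(** The difference quotient at 0 is eventually positive, so [F t - F 0] has the sign of [t]. *)
Lemma derive_sign F a : is_derive (0 : R) 1 F a -> 0 < a ->
  \forall t \near (0 : R), (0 < t -> F 0 < F t) /\ (t < 0 -> F t < F 0).
Proof.
move=> [dF dE] a0.
have : h^-1 *: (F (h *: (1 : R^o) + 0 : R) - F 0) @[h --> 0^'] --> a.
  by rewrite -dE; exact: dF.
move=> /cvgr_gt /(_ 0 a0); rewrite near_withinE => H.
near=> t.
have Ht : t != 0 -> 0 < t^-1 *: (F (t *: 1 + 0) - F 0) by near: t.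
rewrite addr0 [_%:A]mulr1 /GRing.scale/= in Ht.
split=> t0.
- by move: (Ht (lt0r_neq0 t0)); rewrite pmulr_rgt0 ?invr_gt0// subr_gt0.
- move: (Ht (ltr0_neq0 t0)); rewrite nmulr_rgt0 ?invr_lt0// subr_lt0//.
Unshelve. all: by end_near. Qed.

(** A negative slope would make [F] larger than [F 0] just to the left of 0. The one-sided form
    serves a maximum known only on the inner side of a sphere. *)
Lemma derive_left_max F a : is_derive (0 : R) 1 F a ->
  (\forall t \near (0 : R), t < 0 -> F t <= F 0) -> 0 <= a.
Proof.
move=> dF Fmax; rewrite leNgt; apply/negP => a0.
have dN : is_derive (0 : R) 1 (- F) (- a) by exact: is_deriveN.
have := derive_sign _ _ dN; rewrite oppr_gt0 => /(_ a0) H.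
have {H} : \forall t \near (0 : R), ~ (t < 0).
  near=> t => t0.
  have : F t <= F 0 by move: t0; near: t.
  rewrite leNgt => /negP; apply; rewrite -ltrN2.
  by have [_ /(_ t0)] : (0 < t -> (- F) 0 < (- F) t) /\
    (t < 0 -> (- F) t < (- F) 0) by near: t.
move=> /nbhs_ballP[e /= e0 /(_ (- (e / 2)))]; apply.
- rewrite /ball/= sub0r opprK gtr0_norm ?divr_gt0//.
  by rewrite ltr_pdivrMr// ltr_pMr// ltr1n.
- by rewrite oppr_lt0 divr_gt0.
Unshelve. all: by end_near. Qed.

Lemma jet2_max F a b : jet2 F a b ->
  (\forall t \near (0 : R), F t <= F 0) -> a = 0 /\ b <= 0.
Proof.
move=> [F' [dF F0 ddF]] Fmax.
have d0 : is_derive (0 : R) 1 F a by rewrite -F0; exact: nbhs_singleton dF.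
have a0 : a = 0.
  apply/eqP; rewrite eq_le; apply/andP; split; last first.
    by apply: (derive_left_max _ _ d0); near=> t => _; near: t.
  rewrite leNgt; apply/negP => a0.
  have /nbhs_ballP[e /= e0 /(_ (e / 2))] : \forall t \near (0 : R), ~ (0 < t).
    near=> t => t0.
    have : F t <= F 0 by near: t.
    rewrite leNgt => /negP; apply.
    have [/(_ t0)] : (0 < t -> F 0 < F t) /\ (t < 0 -> F t < F 0).
      by near: t; exact: derive_sign a0.
    by [].
  apply; last by rewrite divr_gt0.
  rewrite /ball/= sub0r normrN gtr0_norm ?divr_gt0//.
  by rewrite ltr_pdivrMr// ltr_pMr// ltr1n.
(* If [b > 0], then [F'], vanishing at 0, is positive just to the right, and the mean value theorem
   on [[0, e / 2]] gives [F (e / 2) > F 0]. *)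
split=> //; rewrite leNgt; apply/negP => b0.
have := derive_sign _ _ ddF b0; rewrite F0 a0 => sF.
have : \forall t \near (0 : R), [/\ is_derive (t : R) 1 F (F' t), F t <= F 0
    & 0 < t -> 0 < F' t].
  near=> t; split; [by near: t|by near: t|].
  by have [] : (0 < t -> 0 < F' t) /\ (t < 0 -> F' t < 0) by near: t.
move=> /nbhs_ballP[e /= e0 He].
have e2 : 0 < e / 2 by rewrite divr_gt0.
have e2e : e / 2 < e by rewrite ltr_pdivrMr// ltr_pMr// ltr1n.
have inb t : 0 <= t <= e / 2 -> ball (0 : R) e t.
  move=> /andP[t0 te]; rewrite /ball/= sub0r normrN ger0_norm//.
  exact: le_lt_trans e2e.
have dt t : t \in `]0, (e / 2)[%R -> is_derive t 1 F (F' t).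
  rewrite in_itv/= => /andP[t0 te].
  by have /inb/He[] : 0 <= t <= e / 2 by rewrite !ltW.
have cF : {within `[0, (e / 2)], continuous F}.
  apply: derivable_within_continuous => t; rewrite in_itv/= => /inb/He[dt' _ _].
  exact: ex_derive.
have [c c0 cE] := MVT e2 dt cF.
have /inb/He[_ Fe _] : 0 <= e / 2 <= e / 2 by rewrite lexx ltW.
have : 0 < F (e / 2) - F 0.
  rewrite cE subr0 mulr_gt0//.
  move: c0; rewrite in_itv/= => /andP[c0 ce].
  by have /inb/He[_ _] : 0 <= c <= e / 2; [rewrite !ltW | apply].
by rewrite subr_gt0 ltNge Fe.
Unshelve. all: by end_near. Qed.

End Jets.

(** * The Euclidean norm *)

Section Euclidean.
Context {R : realType} {N : nat}.
Implicit Types (x v : 'rV[R]_N).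

Lemma enorm_ge0 x : 0 <= enorm x.
Proof. exact: sqrtr_ge0. Qed.

Lemma enorm_sqr x : enorm x ^+ 2 = \sum_(i < N) x ord0 i ^+ 2.
Proof. by rewrite sqr_sqrtr// sumr_ge0// => i _; exact: sqr_ge0. Qed.

Lemma enormZ a x : enorm (a *: x) = `|a| * enorm x.
Proof.
rewrite /enorm -sqrtr_sqr -sqrtrM ?sqr_ge0//; congr Num.sqrt.
by rewrite mulr_sumr; apply: eq_bigr => i _; rewrite mxE exprMn.
Qed.

Lemma enorm_line x v (t : R) : enorm (t *: v + x) ^+ 2 =
  enorm x ^+ 2 + 2 * (\sum_i x ord0 i * v ord0 i) * t + enorm v ^+ 2 * t ^+ 2.
Proof.
rewrite !enorm_sqr mulr_sumr !mulr_suml -!big_split/=.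
by apply: eq_bigr => i _; rewrite !mxE; ring.
Qed.

Lemma enorm_evec (i : 'I_N) : enorm (evec R i) ^+ 2 = 1.
Proof.
rewrite enorm_sqr (bigD1 i)//= big1 ?mxE ?eqxx ?expr1n ?addr0// => j ji.
by rewrite mxE (negPf ji) expr0n.
Qed.

(** The ambient norm on row vectors is the maximum norm; this comparison turns Euclidean bounds into
    boundedness. *)
Lemma normr_le_enorm x : `|x| <= enorm x.
Proof.
rewrite [leLHS]/Num.norm /= mx_normrE.
apply: bigmax_le => [|[i j] _ /=]; first exact: enorm_ge0.
rewrite (ord1 i) -sqrtr_sqr ler_sqrt; last first.
  by rewrite sumr_ge0// => k _; exact: sqr_ge0.
by rewrite (bigD1 j)//= lerDl sumr_ge0// => k _; exact: sqr_ge0.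
Qed.

Lemma enorm_continuous : continuous (@enorm R N).
Proof.
move=> x.
apply: (continuous_comp (f := fun y : 'rV[R]_N => \sum_i y ord0 i ^+ 2));
  last exact: sqrt_continuous.
move: x; apply: (continuous_big (op := +%R) (x0 := 0)) => [|i _].
  exact: add_continuous.
move=> x; apply: (@continuous_comp _ _ _ (fun y : 'rV[R]_N => y ord0 i)
  (fun z : R => z ^+ 2)).
  exact: coord_continuous.
exact: exprn_continuous.
Qed.

Lemma jet2_enorm_sqr x v : jet2 (fun t => enorm (t *: v + x) ^+ 2)
  (2 * \sum_i x ord0 i * v ord0 i) (2 * enorm v ^+ 2).
Proof.
have -> : (fun t => enorm (t *: v + x) ^+ 2) = (fun t : R => enorm x ^+ 2 +
  (2 * \sum_i x ord0 i * v ord0 i) * t + enorm v ^+ 2 * t ^+ 2).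
  by apply/funext => t; exact: enorm_line.
have := jet2D _ _ _ _ _ _ (jet2D _ _ _ _ _ _ (jet2_cst (enorm x ^+ 2))
  (jet2Z (2 * \sum_i x ord0 i * v ord0 i) _ _ _ jet2_id))
  (jet2Z (enorm v ^+ 2) _ _ _ jet2_sqr).
by rewrite !mulr0 !addr0 !add0r mulr1 (mulrC _ 2).
Qed.

End Euclidean.

(** * Second derivatives and the p-Laplacian at a noncritical point *)

Section SecondDerivatives.
Context {R : realType} {N : nat}.
Implicit Types (f : 'rV[R]_N -> R) (x v : 'rV[R]_N).

(** The Hessian quadratic form at [x], evaluated on [v]. *)
Definition D2 f v x : R := \sum_k v ord0 k * 'D_v (partial k f) x.

(** The linear operator [Delta + (p-2) D^2_vv]. The Laplacian is written through [D2], so that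
    bounds on [D2] in every direction carry over directly. *)
Definition plin (p : R) v f x : R :=
  \sum_i D2 f (evec R i) x + (p - 2) * D2 f v x.

Lemma derive_partial f x v : differentiable f x ->
  'D_v f x = \sum_i v ord0 i * partial i f x.
Proof.
move=> df; rewrite deriveE// [v in LHS]row_sum_delta linear_sum.
by apply: eq_bigr => i _; rewrite linearZ /partial deriveE.
Qed.

Lemma D2_evec f i x : D2 f (evec R i) x = partial i (partial i f) x.
Proof.
rewrite /D2 (bigD1 i)//= big1 ?addr0; last first.
  by move=> j ji; rewrite mxE (negPf ji) andbF mul0r.
by rewrite mxE !eqxx mul1r.
Qed.

(** Near [x] the derivative along the line is the combination of the partials with weights [v], and
    each partial is differentiable at [x]. *)
Lemma jet2_line f x v :
  (\forall y \near x, differentiable f y) ->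
  (forall i, differentiable (partial i f) x) ->
  jet2 (fun t => f (t *: v + x)) ('D_v f x) (D2 f v x).
Proof.
move=> df ddf.
exists (fun t => \sum_k v ord0 k * partial k f (t *: v + x)); split.
- have : \forall t \near (0 : R), differentiable f (t *: v + x).
    exact: (line_cvg0 x v _ df).
  apply: filterS => t dft; apply: is_derive_line.
  by rewrite -derive_partial//; exact/derivableP/diff_derivable.
- rewrite -derive_partial; rewrite scale0r add0r//.
  exact: nbhs_singleton df.
- rewrite /D2.
  have -> : (fun t : R => \sum_k v ord0 k * partial k f (t *: v + x)) =
    \sum_k (v ord0 k *: (fun t : R => partial k f (t *: v + x))).
    by apply/funext => t; rewrite fct_sumE.
  apply: is_derive_sum => k; apply: is_deriveZ; apply: is_derive_line.
  by rewrite scale0r add0r; exact/derivableP/diff_derivable.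
Qed.

(** Since the gradient is [a v] with [a > 0], both its norm and the power of that norm are
    differentiable at [x], and the product rule applies. *)
Lemma plapE p f x v (a : R) : 0 < a -> enorm v = 1 ->
  (forall i, differentiable (partial i f) x) ->
  (forall i, partial i f x = a * v ord0 i) ->
  plap p f x = a `^ (p - 2) * plin p v f x.
Proof.
move=> a0 v1 ddf fx.
(* [S i] will be the derivative of the gradient norm along the [i]-th axis. *)
pose S i := \sum_k v ord0 k * 'D_(evec R i) (partial k f) x.
have Gx : \sum_k (partial k f x) ^+ 2 = a ^+ 2.
  rewrite -[RHS]mulr1 -[X in _ * X](expr1n _ 2) -v1 enorm_sqr mulr_sumr.
  by apply: eq_bigr => k _; rewrite fx exprMn.
have gE y : enorm (grad f y) = Num.sqrt (\sum_k (partial k f y) ^+ 2).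
  by congr Num.sqrt; apply: eq_bigr => k _; rewrite mxE.
have gx : enorm (grad f x) = a by rewrite gE Gx sqrtr_sqr gtr0_norm.
have dG i : is_derive x (evec R i) (fun y => \sum_k (partial k f y) ^+ 2)
    (2 * a * S i).
  have -> : (fun y => \sum_k (partial k f y) ^+ 2) =
      \sum_k (partial k f * partial k f).
    apply/funext => y; rewrite fct_sumE.
    by apply: eq_bigr => k _; rewrite expr2.
  rewrite /S mulr_sumr; apply: is_derive_sum => k.
  have dk : is_derive x (evec R i) (partial k f)
      ('D_(evec R i) (partial k f) x).
    exact/derivableP/diff_derivable.
  apply: (is_derive_eq (is_deriveM dk dk)).
  by rewrite /GRing.scale/= fx; ring.
have dg i : is_derive x (evec R i) (fun y => enorm (grad f y)) (S i).
  have -> : (fun y => enorm (grad f y)) =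
     (fun y => Num.sqrt (\sum_k (partial k f y) ^+ 2)) by apply/funext.
  have ds : is_derive (\sum_k (partial k f x) ^+ 2) 1 Num.sqrt (2 * a)^-1.
    rewrite Gx; apply: is_derive_eq.
      by apply: is_derive1_sqrt; rewrite exprn_gt0.
    by rewrite sqrtr_sqr gtr0_norm.
  have := is_derive_chain _ _ _ _ _ _ ds (dG i).
  by rewrite mulrA mulVf ?mul1r// mulf_neq0// gt_eqF.
have dp i : partial i (fun y => enorm (grad f y) `^ (p - 2) * partial i f y) x =
   a `^ (p - 2) * (D2 f (evec R i) x + (p - 2) * (v ord0 i * S i)).
  have da : is_derive (enorm (grad f x)) 1 (@powR R ^~ (p - 2))
      ((p - 2) * a `^ (p - 2 - 1)).
    by rewrite gx; exact: is_derive1_powR.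
  have dP := is_derive_chain _ (fun y => enorm (grad f y)) _ _ _ _ da (dg i).
  have di : is_derive x (evec R i) (partial i f)
      ('D_(evec R i) (partial i f) x).
    exact/derivableP/diff_derivable.
  have [_] := is_deriveM dP di; rewrite /GRing.scale/= gx fx => dE.
  rewrite [LHS]dE D2_evec -/(partial i (partial i f) x).
  have -> : a `^ (p - 2) = a `^ (p - 2 - 1) * a.
    rewrite -[X in _ * X](powRr1 (ltW a0)) -powRD ?subrK//.
    by rewrite (gt_eqF a0) implybT.
  by ring.
rewrite /plap (eq_bigr _ (fun i _ => dp i)) -mulr_sumr; congr (_ * _).
rewrite /plin big_split/= -mulr_sumr; congr (_ + _ * _).
(* Summing the axis derivatives of a partial with weights [v] yields its derivative along [v], which
   reassembles [D2 f v x]. *)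
rewrite /S /D2; under eq_bigr do rewrite mulr_sumr.
rewrite exchange_big/=; apply: eq_bigr => k _.
rewrite derive_partial// mulr_sumr; apply: eq_bigr => i _.
by rewrite mulrCA.
Qed.

End SecondDerivatives.

(** * Radial functions on the annulus *)

Section Annulus.
Context {R : realType} {N : nat}.
Implicit Types (f u : 'rV[R]_N -> R) (x v : 'rV[R]_N).

Lemma C2_at (r0 : R) R0 f x : C2 r0 R0 f -> Bclosed r0 R0 x ->
  (\forall y \near x, differentiable f y) /\
  (forall i, differentiable (partial i f) x).
Proof.
move=> [U [oU BU fU]] /BU Ux; split; last by have [] := fU x Ux.
have : nbhs x U by exact: open_nbhs_nbhs.
by apply: filterS => y /fU[].
Qed.

Lemma near_Bopen (r0 : R) R0 x : Bopen r0 R0 x ->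
  \forall y \near x, Bopen r0 R0 y.
Proof.
move=> [x0 xR].
have cx : enorm y @[y --> x] --> enorm x by exact: enorm_continuous.
have gt0 : \forall y \near x, r0 < enorm y by exact: (cvgr_gt _ cx).
case: R0 xR => [R0| |] xR //.
- have lt0 : \forall y \near x, enorm y < R0.
    by apply: (cvgr_lt _ cx); rewrite lte_fin in xR.
  by near=> y; split; [near: y | rewrite lte_fin; near: y].
- by near=> y; split; [near: y | rewrite ltry].
Unshelve. all: by end_near. Qed.

Lemma Bopen_closed (r0 : R) R0 x : Bopen r0 R0 x -> Bclosed r0 R0 x.
Proof. by move=> [x0 xR]; split=> //; exact: ltW. Qed.

Lemma radial_eq (r0 : R) R0 f x y : radial r0 R0 f -> Bclosed r0 R0 x ->
  enorm y = enorm x -> f y = f x.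
Proof.
move=> [phi fE] Bx yx; rewrite (fE _ Bx) fE ?yx//.
by rewrite /Bclosed /= yx.
Qed.

(* In a direction tangent to the sphere, a radial function is even along the
   line, so its derivative there vanishes. *)
Lemma radial_derive_tangent (r0 : R) R0 f x v :
  radial r0 R0 f -> Bopen r0 R0 x ->
  differentiable f x -> \sum_i x ord0 i * v ord0 i = 0 -> 'D_v f x = 0.
Proof.
move=> radf Bx df xv0.
have : 'D_v f x = 'D_(- v) f x.
  apply: cvg_lim => //.
  have := @diff_derivable _ _ _ f x (- v) df; rewrite /derivable.
  rewrite -/(derive f x (- v)) => Hl.
  apply: cvg_trans Hl; apply: near_eq_cvg.
  apply: cvg_within.
  have Bv : \forall t \near (0 : R), Bopen r0 R0 (t *: v + x).
    exact: (line_cvg0 x v _ (near_Bopen _ _ _ Bx)).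
  near=> t; congr (_ *: (_ - _)) => /=.
  apply: (radial_eq r0 R0) => //; first by apply: Bopen_closed; near: t.
  apply/eqP; rewrite -(@eqrXn2 _ 2)// ?enorm_ge0//; apply/eqP.
  rewrite scalerN -scaleNr !enorm_line xv0; ring.
by rewrite !deriveE// linearN; lra.
Unshelve. all: by end_near. Qed.

(** The gradient of a radial function is parallel to [x]: each axis vector is a multiple of [x] plus
    a tangent vector, and the latter contributes nothing. *)
Lemma radial_partial (r0 : R) R0 f x i :
  0 < r0 -> radial r0 R0 f -> Bopen r0 R0 x ->
  differentiable f x ->
  partial i f x = rad_deriv f x * ((enorm x)^-1 *: x) ord0 i.
Proof.
move=> r00 radf Bx df.
have x0 : 0 < enorm x by case: Bx => /(lt_trans r00).
(* The component of the axis vector orthogonal to [x]. *)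
pose v := evec R i - (x ord0 i / enorm x ^+ 2) *: x.
have xi : \sum_k x ord0 k * evec R i ord0 k = x ord0 i.
  rewrite (bigD1 i)//= big1 ?addr0 ?mxE ?eqxx ?mulr1// => j ji.
  by rewrite mxE (negPf ji) mulr0.
have : 'D_v f x = 0.
  apply: (radial_derive_tangent r0 R0) => //.
  have vE k : x ord0 k * v ord0 k =
      x ord0 k * evec R i ord0 k - x ord0 i / enorm x ^+ 2 * x ord0 k ^+ 2.
    by rewrite /v !mxE; ring.
  rewrite (eq_bigr _ (fun k _ => vE k)) sumrB xi -mulr_sumr -enorm_sqr.
  by rewrite divfK ?subrr// expf_neq0// gt_eqF.
rewrite /partial /rad_deriv /v !deriveE// linearB !linearZ/= !mxE => /eqP.
rewrite scalerN subr_eq0 => /eqP ->.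
by rewrite /GRing.scale/=; field; exact: lt0r_neq0.
Qed.

End Annulus.

(** * Convexity of powers *)

Section Convexity.
Context {R : realType}.

(** Convexity of [z^(q+1)] with weights [A / (A + B)] and [B / (A + B)], where [s] is the mean.
    Writing the power as [z * z^q] fits the potential term produced by [LopE]. *)
Lemma powR_convex_sum (q A B x y s : R) : 0 <= q -> 0 < A -> 0 < B ->
  0 <= x -> 0 <= y -> (A + B) * s = A * x + B * y ->
  (A * x + B * y) * s `^ q <= A * (x * x `^ q) + B * (y * y `^ q).
Proof.
move=> q0 A0 B0 x0 y0 sE.
have AB0 : 0 < A + B by rewrite addr_gt0.
have powS z : 0 <= z -> z * z `^ q = z `^ (q + 1).
  move=> z0; rewrite powRD ?powRr1 1?mulrC//.
  by rewrite (gt_eqF (ltr_wpDl q0 ltr01)).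
have s0 : 0 <= s.
  by rewrite -(pmulr_rge0 _ AB0) sE addr_ge0 ?mulr_ge0// ltW.
have t01 : 0 <= A / (A + B) <= 1.
  by rewrite divr_ge0 ?(ltW A0) ?(ltW AB0)//= ler_pdivrMr// mul1r lerDl ltW.
pose t : {i01 R} := Itv01 (proj1 (andP t01)) (proj2 (andP t01)).
have q1 : 1 <= q + 1 by rewrite lerDr.
have := convex_powR q1 t.
move=> /(_ x y); rewrite !inE/= !in_itv/= !andbT => /(_ x0 y0).
rewrite convRE [X in X `^ _ <= _]convRE /= /unstable.onem.
have -> : A / (A + B) * x + (1 - A / (A + B)) * y = s.
  by apply: (mulfI (lt0r_neq0 AB0)); rewrite sE; field; exact: lt0r_neq0.
rewrite -!powS// => H.
have -> : (A * x + B * y) * s `^ q = (A + B) * (s * s `^ q).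
  by rewrite -sE mulrA.
have -> : A * (x * x `^ q) + B * (y * y `^ q) =
    (A + B) * (A / (A + B) * (x * x `^ q) + (1 - A / (A + B)) * (y * y `^ q)).
  by field; exact: lt0r_neq0.
by rewrite ler_pM2l.
Qed.

End Convexity.

(** * Impossibility of touching from below *)

Section Touching.
Context {R : realType} {N : nat}.
Implicit Types (f u v w V : 'rV[R]_N -> R) (x e : 'rV[R]_N).

(** Factoring out the positive number [a^(p-2)] leaves an expression linear in the second
    derivatives, whose sign decides that of the operator. *)
Lemma LopE (p : R) V f x e (a : R) : 0 < a -> enorm e = 1 -> 0 < f x ->
  (forall i, differentiable (partial i f) x) ->
  (forall i, partial i f x = a * e ord0 i) ->
  Lop p V f x =
    - (a `^ (p - 2) * (plin p e f x + V x * ((f x / a) `^ (p - 2) * f x))).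
Proof.
move=> a0 e1 fx0 ddf fx; rewrite /Lop (plapE p f x e a)// gtr0_norm//.
have -> : f x `^ (p - 2) = (f x / a) `^ (p - 2) * a `^ (p - 2).
  by rewrite -powRM ?divr_ge0 ?ltW// divfK ?gt_eqF.
by ring.
Qed.

Lemma plin_lin3 (p : R) e u v w x (a b : R) : 2 <= p ->
  (forall d, D2 u d x + a * D2 v d x + b * D2 w d x <= 0) ->
  plin p e u x + a * plin p e v x + b * plin p e w x <= 0.
Proof.
move=> p2 H; rewrite /plin.
have S0 : \sum_i D2 u (evec R i) x + a * (\sum_i D2 v (evec R i) x) +
    b * (\sum_i D2 w (evec R i) x) <= 0.
  by rewrite !mulr_sumr -!big_split/=; apply: sumr_le0.
have T0 : (p - 2) * (D2 u e x + a * D2 v e x + b * D2 w e x) <= 0.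
  by rewrite mulr_ge0_le0// subr_ge0.
have E (q su sv sw du dv dw : R) :
    su + q * du + a * (sv + q * dv) + b * (sw + q * dw) =
    (su + a * sv + b * sw) + q * (du + a * dv + b * dw) by ring.
by rewrite E -[leRHS]addr0 lerD.
Qed.

(* Subadditivity of [(a, alpha) |-> a ^ (p-1) / alpha ^ (p-2)], which is convex
   and 1-homogeneous, contradicts the three differential inequalities. *)
Lemma no_touching_difference V u v w x (p tau M : R) :
  2 <= p -> 0 < enorm x -> 0 <= V x ->
  0 < tau -> 0 < M -> 0 < v x -> 0 < w x ->
  u x = tau * v x + M * w x ->
  (\forall y \near x, u y <= tau * v y + M * w y) ->
  (\forall y \near x, differentiable u y) ->
  (forall i, differentiable (partial i u) x) ->
  (\forall y \near x, differentiable v y) ->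
  (forall i, differentiable (partial i v) x) ->
  (\forall y \near x, differentiable w y) ->
  (forall i, differentiable (partial i w) x) ->
  (forall i, partial i u x = rad_deriv u x * ((enorm x)^-1 *: x) ord0 i) ->
  (forall i, partial i v x = rad_deriv v x * ((enorm x)^-1 *: x) ord0 i) ->
  0 < rad_deriv v x -> tau * rad_deriv v x < rad_deriv u x ->
  Lop p V u x <= 0 -> 0 < Lop p V v x -> 0 <= Lop p V w x -> False.
Proof.
move=> p2 x0 Vx tau0 M0 vx wx ux umax du ddu dv ddv dw ddw pu pv b0 ab Lu Lv Lw.
set e := (enorm x)^-1 *: x in pu pv.
set a := rad_deriv u x in pu ab; set b := rad_deriv v x in pv b0 ab.
have e1 : enorm e = 1.
  by rewrite enormZ gtr0_norm ?invr_gt0// mulVf ?gt_eqF.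
(* The slope of [w] at [x], as dictated by the first-order condition [a = tau b + M g]. *)
pose g := (a - tau * b) / M.
have g0 : 0 < g by rewrite divr_gt0// subr_gt0.
have a0 : 0 < a by apply: lt_trans ab; exact: mulr_gt0.
have J d : 'D_d u x + - tau * 'D_d v x + - M * 'D_d w x = 0 /\
    D2 u d x + - tau * D2 v d x + - M * D2 w d x <= 0.
  apply: (jet2_max _ _ _ (jet2D _ _ _ _ _ _ (jet2D _ _ _ _ _ _
    (jet2_line u x d du ddu) (jet2Z (- tau) _ _ _ (jet2_line v x d dv ddv)))
    (jet2Z (- M) _ _ _ (jet2_line w x d dw ddw)))).
  have H := line_cvg0 x d _ umax.
  near=> t; rewrite scale0r add0r ux.
  have : u (t *: d + x) <= tau * v (t *: d + x) + M * w (t *: d + x) by near: t.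
  move=> ut; rewrite !mulNr -addrA -opprD -[leRHS]addrA -opprD.
  by rewrite subrr subr_le0.
have pw i : partial i w x = g * e ord0 i.
  have [+ _] := J (evec R i); rewrite -!/(partial i _ x) pu pv => H.
  apply: (mulfI (lt0r_neq0 M0)); rewrite mulrA.
  have -> : M * g = a - tau * b by rewrite /g mulrC divfK ?gt_eqF.
  by rewrite mulrBl; apply/eqP; rewrite -subr_eq0 -oppr_eq0 -H; apply/eqP; ring.
have := plin_lin3 p e u v w x _ _ p2 (fun d => (J d).2).
have ux0 : 0 < u x by rewrite ux addr_gt0// mulr_gt0.
move: Lu Lv Lw.
rewrite (LopE p V u x e a)// (LopE p V v x e b)// (LopE p V w x e g)//.
rewrite oppr_le0 oppr_gt0 oppr_ge0 pmulr_rge0 ?powR_gt0//.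
rewrite pmulr_rlt0 ?powR_gt0// pmulr_rle0 ?powR_gt0//.
set Lu := plin _ _ u _; set Lv := plin _ _ v _; set Lw := plin _ _ w _.
move=> Hu Hv Hw HL.
have q0 : 0 <= p - 2 by rewrite subr_ge0.
(* The weights [tau * b] and [M * g] add up to [a], and equality at [x] makes [u x / a] the weighted
   mean of [v x / b] and [w x / g]. *)
have := powR_convex_sum (p - 2) (tau * b) (M * g) (v x / b) (w x / g) (u x / a)
  q0 (mulr_gt0 tau0 b0) (mulr_gt0 M0 g0) (ltW (divr_gt0 vx b0))
  (ltW (divr_gt0 wx g0)).
have -> : tau * b + M * g = a by rewrite /g mulrCA divff ?gt_eqF// mulr1; ring.
have -> : tau * b * (v x / b) = tau * v x by field; exact: lt0r_neq0.
have -> : M * g * (w x / g) = M * w x by field; exact: lt0r_neq0.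
rewrite -ux mulrCA divff ?gt_eqF// mulr1 => /(_ erefl).
have -> : tau * b * (v x / b * (v x / b) `^ (p - 2)) =
  tau * ((v x / b) `^ (p - 2) * v x) by field; exact: lt0r_neq0.
have -> : M * g * (w x / g * (w x / g) `^ (p - 2)) =
  M * ((w x / g) `^ (p - 2) * w x) by field; exact: lt0r_neq0.
rewrite [u x * _]mulrC.
move=> HP; have := ler_wpM2l Vx HP.
(* The inequality for [u] minus [tau] times that for [v] and [M] times that for [w] gives
   [Lu - tau Lv - M Lw > 0], against [HL]; strictness comes from [v]. *)
have K (V0 Pu Pv Pw : R) : 0 <= Lu + V0 * Pu -> Lv + V0 * Pv < 0 ->
    Lw + V0 * Pw <= 0 -> V0 * Pu <= V0 * (tau * Pv + M * Pw) -> False.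
  rewrite -(pmulr_rlt0 _ tau0) -(pmulr_rle0 _ M0) => H1 H2 H3 H4.
  have E : Lu + - tau * Lv + - M * Lw = (Lu + V0 * Pu) - tau * (Lv + V0 * Pv)
    - M * (Lw + V0 * Pw) + (V0 * (tau * Pv + M * Pw) - V0 * Pu) by ring.
  move: HL; apply/negP; rewrite -ltNge E ltr_wpDr ?subr_ge0//.
  by rewrite ltr_wpDr ?oppr_ge0// ltr_wpDl// oppr_gt0.
exact: K Hu Hv Hw.
Unshelve. all: by end_near. Qed.

(** At the contact point the Hessian of [w] is at least [2 delta / M] times the identity, so [plin]
    is positive on [w]; the supersolution inequality with [V x >= 0] makes it nonpositive. *)
Lemma no_touching_paraboloid V w x (p c delta M : R) :
  (0 < N)%N -> 2 <= p -> 0 < enorm x -> 0 <= V x ->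
  0 < delta -> 0 < M -> 0 < w x ->
  c + delta * enorm x ^+ 2 = M * w x ->
  (\forall y \near x, c + delta * enorm y ^+ 2 <= M * w y) ->
  (\forall y \near x, differentiable w y) ->
  (forall i, differentiable (partial i w) x) ->
  0 <= Lop p V w x -> False.
Proof.
move=> N0 p2 x0 Vx delta0 M0 wx wE wmax dw ddw Lw.
pose e := (enorm x)^-1 *: x.
have e1 : enorm e = 1.
  by rewrite enormZ gtr0_norm ?invr_gt0// mulVf ?gt_eqF.
(* Forced by the first-order condition: [M] times the gradient of [w] equals [2 delta x]. *)
pose g := 2 * delta * enorm x / M.
have g0 : 0 < g by rewrite divr_gt0// !mulr_gt0.
have J (d : 'rV[R]_N) :
    0 + delta * (2 * \sum_i x ord0 i * d ord0 i) + - M * 'D_d w x = 0 /\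
    0 + delta * (2 * enorm d ^+ 2) + - M * D2 w d x <= 0.
  apply: (jet2_max _ _ _ (jet2D _ _ _ _ _ _ (jet2D _ _ _ _ _ _ (jet2_cst c)
    (jet2Z delta _ _ _ (jet2_enorm_sqr x d)))
    (jet2Z (- M) _ _ _ (jet2_line w x d dw ddw)))).
  have H := line_cvg0 x d _ wmax.
  near=> t; rewrite scale0r add0r.
  have : c + delta * enorm (t *: d + x) ^+ 2 <= M * w (t *: d + x) by near: t.
  by rewrite !mulNr wE subrr -subr_le0.
have pw i : partial i w x = g * e ord0 i.
  have [+ _] := J (evec R i); rewrite -!/(partial i _ x).
  rewrite (bigD1 i)//= big1 ?addr0 ?mxE ?eqxx ?mulr1; last first.
    by move=> j ji; rewrite mxE (negPf ji) mulr0.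
  move=> H; apply: (mulfI (lt0r_neq0 M0)); rewrite /g.
  have -> : M * (2 * delta * enorm x / M * ((enorm x)^-1 * x ord0 i)) =
    2 * delta * x ord0 i by field; rewrite !gt_eqF.
  by apply/eqP; rewrite -subr_eq0 -oppr_eq0 -H; apply/eqP; ring.
move: Lw; rewrite (LopE p V w x e g)// oppr_ge0 pmulr_rle0 ?powR_gt0//.
apply/negP; rewrite -ltNge ltr_pwDl//; last first.
  by rewrite mulr_ge0// mulr_ge0 ?powR_ge0// ltW.
have Jd (d : 'rV[R]_N) : 2 * delta / M * enorm d ^+ 2 <= D2 w d x.
  have [_ H] := J d; rewrite -(ler_pM2l M0).
  have -> : M * (2 * delta / M * enorm d ^+ 2) = delta * (2 * enorm d ^+ 2).
    by field; exact: lt0r_neq0.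
  by rewrite -subr_le0; move: H; rewrite add0r mulNr.
have k0 : 0 < 2 * delta / M by rewrite divr_gt0// mulr_gt0.
rewrite /plin ltr_pwDl//; last first.
  by rewrite mulr_ge0 ?subr_ge0// (le_trans _ (Jd e))// mulr_ge0 ?sqr_ge0// ltW.
apply: (@lt_le_trans _ _ (\sum_(i < N) (2 * delta / M))).
  by rewrite sumr_const card_ord pmulrn_lgt0.
by apply: ler_sum => i _; have := Jd (evec R i); rewrite enorm_evec mulr1.
Unshelve. all: by end_near. Qed.

End Touching.

(** * Monotonicity in the radius *)

Section Monotone.
Context {R : realType} {N : nat}.
Implicit Types (u : 'rV[R]_N -> R) (x y : 'rV[R]_N).

(** Radiality moves [x] onto the ray through [y]; the mean value theorem along that ray then uses
    the sign of the radial derivative. *)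
Lemma mono_inc_le (r0 : R) R0 u x y : 0 < r0 -> C2 r0 R0 u ->
  radial r0 R0 u -> mono_inc r0 R0 u -> Bclosed r0 R0 x -> Bclosed r0 R0 y ->
  enorm x <= enorm y -> u x <= u y.
Proof.
move=> r00 uC2 radu monou [rx xR] [ry yR] xy.
have x0 : 0 < enorm x by exact: lt_le_trans rx.
have y0 : 0 < enorm y by exact: lt_le_trans ry.
pose a := enorm x / enorm y.
have a0 : 0 < a by rewrite divr_gt0.
have a1 : a <= 1 by rewrite ler_pdivrMr// mul1r.
have By t : a <= t <= 1 -> Bclosed r0 R0 (t *: y).
  move=> /andP[at1 t1]; have t0 : 0 < t by exact: lt_le_trans at1.
  rewrite /Bclosed/= enormZ gtr0_norm//; split.
    by rewrite (le_trans rx)// -ler_pdivrMr.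
  by apply: le_lt_trans yR; rewrite lee_fin ler_piMl// ltW.
have -> : u x = u (a *: y).
  apply: (radial_eq r0 R0 _ _ _ radu); first by apply: By; rewrite lexx.
  by rewrite enormZ gtr0_norm// divfK// gt_eqF.
have dt t : a <= t <= 1 ->
    is_derive t 1 (fun s : R => u (s *: y + 0)) ('D_y u (t *: y + 0)).
  move=> t1; apply: is_derive_line.
  apply/derivableP/diff_derivable; rewrite addr0.
  by have [/nbhs_singleton] := C2_at _ _ _ _ uC2 (By t t1).
have [||c c1] := MVT_segment a1 (f := fun s : R => u (s *: y + 0))
    (df := fun t => 'D_y u (t *: y + 0)).
- by move=> t; rewrite in_itv/= => /andP[ta t1]; apply: dt; rewrite !ltW.
- apply: derivable_within_continuous => t; rewrite in_itv/= => /dt dt1.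
  exact: ex_derive.
rewrite !addr0 scale1r => uE; rewrite -subr_ge0 uE mulr_ge0 ?subr_ge0//.
move: c1; rewrite in_itv/= => c1.
have c0 : 0 < c by case/andP: c1 => /(lt_le_trans a0).
have dc : differentiable u (c *: y).
  by have [/nbhs_singleton] := C2_at _ _ _ _ uC2 (By c c1).
have := monou _ (By c c1); rewrite /rad_deriv enormZ gtr0_norm// scalerA.
rewrite !deriveE// linearZ/= pmulr_rge0//.
by rewrite invfM mulrAC mulVf ?mul1r ?invr_gt0 ?gt_eqF.
Qed.

End Monotone.

(** * The doubled maximum over pairs of points *)

Section Maximum.
Context {R : realType} {N : nat}.
Implicit Types (g u v w : 'rV[R]_N -> R) (x y : 'rV[R]_N).

Lemma annulus_compact (a b : R) :
  compact [set x : 'rV[R]_N | a <= enorm x <= b].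
Proof.
apply: bounded_closed_compact.
  exists b; split; first exact: num_real.
  move=> M bM x /= /andP[_ xb].
  by rewrite (le_trans (normr_le_enorm x))// (le_trans xb)// ltW.
have -> : [set x : 'rV[R]_N | a <= enorm x <= b] =
    (@enorm R N) @^-1` [set` `[a, b]%R].
  by apply/seteqP; split=> x /=; rewrite in_itv.
apply: closed_comp; last exact: itv_closed.
by move=> x _; exact: enorm_continuous.
Qed.

(** The admissible pairs form a compact set, on which the continuous quotient [Phi] attains its
    maximum [M]. The diagonal pair [(x1, x1)], where the penalty vanishes, bounds [M] from below. *)
Lemma annulus_pair_max (a b delta : R) g w x1 :
  a <= enorm x1 <= b ->
  (forall x, a <= enorm x <= b -> {for x, continuous g}) ->
  (forall x, a <= enorm x <= b -> {for x, continuous w}) ->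
  (forall x, a <= enorm x <= b -> 0 < w x) ->
  exists y x (M : R), [/\ [/\ a <= enorm y, enorm y <= enorm x & enorm x <= b],
    g x1 / w x1 <= M,
    g y + delta * (enorm x ^+ 2 - enorm y ^+ 2) = M * w x &
    forall y' x', a <= enorm y' -> enorm y' <= enorm x' -> enorm x' <= b ->
      g y' + delta * (enorm x' ^+ 2 - enorm y' ^+ 2) <= M * w x'].
Proof.
move=> x1ab gc wc w0.
pose A := [set x : 'rV[R]_N | a <= enorm x <= b].
pose B := [set q : 'rV[R]_N * 'rV[R]_N | 0 <= enorm q.2 - enorm q.1].
pose Phi (q : 'rV[R]_N * 'rV[R]_N) :=
  (g q.1 + delta * (enorm q.2 ^+ 2 - enorm q.1 ^+ 2)) / w q.2.
have c1 (q : 'rV[R]_N * 'rV[R]_N) : enorm q'.1 @[q' --> q] --> enorm q.1.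
  by apply: (cvg_comp _ _ cvg_fst); exact: enorm_continuous.
have c2 (q : 'rV[R]_N * 'rV[R]_N) : enorm q'.2 @[q' --> q] --> enorm q.2.
  by apply: (cvg_comp _ _ cvg_snd); exact: enorm_continuous.
have cB : closed B.
  apply: (@closed_comp _ _
    (fun q : 'rV[R]_N * 'rV[R]_N => enorm q.2 - enorm q.1) [set t | 0 <= t]);
    last exact: closed_ge.
  by move=> q _; apply: cvgB; [exact: c2|exact: c1].
have KE y x : ((A `*` A) `&` B) (y, x) <->
    [/\ a <= enorm y, enorm y <= enorm x & enorm x <= b].
  rewrite /A /B /= subr_ge0.
  split=> [[[/andP[-> _] /andP[_ ->]] ->]//|[ay yx xb]].
  by rewrite ay xb (le_trans ay yx) (le_trans yx xb).
have [|||[y x] /set_mem Kyx Hmax] := @compact_EVT_max _ _ Phi ((A `*` A) `&` B).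
- by exists (x1, x1); apply/KE; case/andP: x1ab.
- by apply: compact_closedI => //; apply: compact_setX; exact: annulus_compact.
- apply: continuous_in_subspaceT => -[y x] /set_mem [[/= Ay Ax] _].
  have cg : g q.1 @[q --> (y, x)] --> g y.
    by apply: (cvg_comp _ _ cvg_fst); exact: gc.
  have cw : w q.2 @[q --> (y, x)] --> w x.
    by apply: (cvg_comp _ _ cvg_snd); exact: wc.
  have d1 := c1 (y, x); have d2 := c2 (y, x).
  apply: cvgM; last by apply: cvgV => //; exact: lt0r_neq0 (w0 _ Ax).
  apply: cvgD => //; apply: cvgM; first exact: cvg_cst.
  by apply: cvgB; rewrite expr2; under eq_cvg do rewrite expr2; exact: cvgM.
have [ay yx xb] := (KE _ _).1 Kyx.
have wx : 0 < w x by apply: w0; rewrite xb (le_trans ay yx).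
exists y, x, (Phi (y, x)); split=> //.
- have := Hmax (x1, x1); rewrite /Phi/= subrr mulr0 addr0; apply.
  by apply/mem_set/KE; case/andP: x1ab.
- by rewrite /Phi/= divfK// gt_eqF.
- move=> y' x' ay' yx' xb'; rewrite -ler_pdivrMr.
    by apply: (Hmax (y', x')); exact/mem_set/KE.
  by apply: w0; rewrite xb' (le_trans ay' yx').
Qed.

End Maximum.

(** * Comparison of the subsolution with a supersolution *)

Section Comparison.
Context {R : realType} {N : nat}.
Implicit Types (f g u v w V : 'rV[R]_N -> R) (x y : 'rV[R]_N).

Lemma exists_between (a b : R) (R0 : \bar R) : (a%:E < R0)%E -> (b%:E < R0)%E ->
  exists rho : R, [/\ a < rho, b < rho & (rho%:E < R0)%E].
Proof.
move=> aR bR; case: R0 aR bR => [c| |]//.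
- rewrite !lte_fin => ac bc; have mc : Num.max a b < c by rewrite gt_max ac.
  exists ((Num.max a b + c) / 2); rewrite lte_fin midf_lt//.
  by have := (midf_lt mc).1; rewrite gt_max => /andP[-> ->].
- move=> _ _; exists (Num.max a b + 1); rewrite ltry.
  by rewrite !ltr_pwDr// le_max lexx ?orbT.
Qed.

Lemma limsup_R0_le0 (r0 : R) R0 f (eps : R) : 0 < eps ->
  ~ (0 < limsup_R0 r0 R0 f)%E ->
  exists rho : R, [/\ r0 < rho, (rho%:E < R0)%E &
    forall x, Bopen rho R0 x -> f x < eps].
Proof.
move=> e0 /negP; rewrite -leNgt => lim0.
have /ereal_inf_lt[_ [rho [r0rho rhoR] <-] H] : (limsup_R0 r0 R0 f < eps%:E)%E.
  by rewrite (le_lt_trans lim0)// lte_fin.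
exists rho; split=> // x Bx; rewrite -lte_fin; apply: le_lt_trans H.
by apply: ereal_sup_ubound; exists x.
Qed.

Lemma C2_continuous (r0 : R) R0 f x : C2 r0 R0 f -> Bclosed r0 R0 x ->
  {for x, continuous f}.
Proof.
move=> fC2 Bx; have [/nbhs_singleton df _] := C2_at _ _ _ _ fC2 Bx.
exact: differentiable_continuous.
Qed.

(** Moving inward from [x] along the radius, [u - tau v - delta |.|^2] stays below its value at [x],
    so its outward derivative there is nonnegative. *)
Lemma max_slope (r0 : R) R0 u v x (tau delta : R) : 0 < r0 -> Bopen r0 R0 x ->
  differentiable u x -> differentiable v x ->
  (forall y, r0 <= enorm y -> enorm y <= enorm x ->
    u y - tau * v y + delta * (enorm x ^+ 2 - enorm y ^+ 2) <=
    u x - tau * v x) ->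
  2 * delta * enorm x <= rad_deriv u x - tau * rad_deriv v x.
Proof.
move=> r00 Bx du dv H.
have x0 : 0 < enorm x by case: Bx => /(lt_trans r00).
set e := (enorm x)^-1 *: x.
have e1 : enorm e = 1.
  by rewrite enormZ gtr0_norm ?invr_gt0// mulVf ?gt_eqF.
have xe : \sum_i x ord0 i * e ord0 i = enorm x.
  under eq_bigr do rewrite mxE mulrCA -expr2.
  by rewrite -mulr_sumr -enorm_sqr expr2 mulrA mulVf ?mul1r ?gt_eqF.
have dl f : differentiable f x ->
    is_derive (0 : R) 1 (fun t : R => f (t *: e + x)) (rad_deriv f x).
  move=> df; apply: is_derive_line; rewrite scale0r add0r.
  exact/derivableP/diff_derivable.
have [F' [/nbhs_singleton dF F0 _]] := jet2_enorm_sqr x e.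
rewrite F0 xe in dF.
have dG := is_deriveB (is_deriveB (dl u du) (is_deriveZ tau (dl v dv)))
  (is_deriveZ delta dF).
have := derive_left_max _ _ dG.
rewrite /GRing.scale/= subr_ge0 => D.
rewrite (mulrC 2 delta) -mulrA.
apply: D; have Bt := line_cvg0 x e _ (near_Bopen _ _ _ Bx).
(* For [t] between [-2|x|] and 0 the point [t e + x] has norm at most [|x|], since
   [2|x|t + t^2 <= 0]. *)
have Bn : \forall t \near (0 : R), - (2 * enorm x) < t.
  by apply: lt_nbhsr; rewrite oppr_lt0 mulr_gt0.
near=> t => t0.
have tx : enorm (t *: e + x) ^+ 2 <= enorm x ^+ 2.
  rewrite enorm_line e1 xe expr1n mul1r -addrA gerDl.
  have -> : 2 * enorm x * t + t ^+ 2 = (t - - (2 * enorm x)) * t by ring.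
  by rewrite nmulr_lle0// subr_ge0 ltW//; near: t.
have [Bt1 _] : Bopen r0 R0 (t *: e + x) by near: t.
have := H (t *: e + x) (ltW Bt1).
rewrite -(@ler_pXn2r _ 2 _ (enorm _))// ?nnegrE ?enorm_ge0// => /(_ tx) Hu.
rewrite -[leLHS]/(u (t *: e + x) - tau * v (t *: e + x)
  - delta * enorm (t *: e + x) ^+ 2).
rewrite -[leRHS]/(u (0 *: e + x) - tau * v (0 *: e + x)
  - delta * enorm (0 *: e + x) ^+ 2) scale0r add0r.
by rewrite lerBrDr -addrA (addrC (- _)) -mulrBr.
Unshelve. all: by end_near. Qed.

Lemma subsolution_le_mul V u v w (p r0 : R) R0 : (0 < N)%N -> 2 <= p ->
  0 < r0 -> (r0%:E < R0)%E ->
  (forall x, Bopen r0 R0 x -> 0 <= V x) ->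
  radial r0 R0 u -> mono_inc r0 R0 u -> subsolution p V r0 R0 u ->
  positive r0 R0 v -> radial r0 R0 v -> strict_mono_inc r0 R0 v ->
  strict_supersolution p V r0 R0 v ->
  positive r0 R0 w -> supersolution p V r0 R0 w ->
  ~ (0 < limsup_R0 r0 R0 (fun x => (u x / w x)%R))%E ->
  exists C : R, 0 < C /\ forall x, Bclosed r0 R0 x -> u x <= C * v x.
Proof.
move=> N0 p2 r00 r0R V0 radu monou [uC2 Lu] v0 radv monov [vC2 Lv].
move=> w0 [wC2 Lw] lim.
have sphere (rho : R) : 0 < rho -> exists z : 'rV[R]_N, enorm z = rho.
  move=> rho0; exists (rho *: evec R (Ordinal N0)); rewrite enormZ gtr0_norm//.
  have : enorm (evec R (Ordinal N0)) = 1; last by move=> ->; rewrite mulr1.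
  by apply/eqP; rewrite -(@eqrXn2 _ 2)// ?enorm_ge0// enorm_evec expr1n.
have [z0 z0E] := sphere _ r00.
have Bz0 : Bclosed r0 R0 z0 by rewrite /Bclosed/= z0E.
have vz0 := v0 _ Bz0.
(* Chosen so that [tau v > |u|] on the inner sphere, where [g] is then negative. *)
pose tau := `|u z0| / v z0 + 1.
have tau0 : 0 < tau by rewrite ltr_wpDl// divr_ge0// ltW.
pose g x := u x - tau * v x.
have gr0 x : enorm x = r0 -> g x < 0.
  move=> xr; rewrite /g (radial_eq _ _ _ _ x radu Bz0) ?z0E//.
  rewrite (radial_eq _ _ _ _ x radv Bz0) ?z0E// subr_lt0 /tau mulrDl mul1r.
  by rewrite divfK ?gt_eqF// ltr_pwDr// ler_norm.
apply: contrapT => noC.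
have [x1 Bx1 gx1] : exists2 x1, Bclosed r0 R0 x1 & 0 < g x1.
  apply: contrapT => no1; apply: noC; exists tau; split=> // x Bx.
  by rewrite leNgt; apply/negP => tx; apply: no1; exists x; rewrite // subr_gt0.
(* The maximum will be at least [g x1 / w x1]; half of it is the threshold below which [u / w] falls
   near [R0]. *)
have M00 : 0 < g x1 / w x1 / 2 by rewrite !divr_gt0// w0.
have [rho0 [r0rho0 rho0R uw]] := limsup_R0_le0 _ _ _ _ M00 lim.
(* Beyond [rho0], so that [u / w] is below the threshold on the outer sphere; beyond [|x1|], so that
   [x1] competes in the maximum. *)
have [rho [rho0rho x1rho rhoR]] := exists_between _ _ _ rho0R Bx1.2.
have rho00 : 0 < rho by rewrite (lt_trans r00)// (lt_trans r0rho0).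
have Bcl x : r0 <= enorm x <= rho -> Bclosed r0 R0 x.
  by move=> /andP[? xrho]; split=> //; rewrite (le_lt_trans _ rhoR)// lee_fin.
have [z zE] := sphere _ rho00.
have Bz : Bclosed r0 R0 z.
  by apply: Bcl; rewrite zE lexx (ltW (lt_trans r0rho0 rho0rho)).
have uz0 : 0 < u z.
  apply: (@lt_le_trans _ _ (u x1)); last first.
    by apply: (mono_inc_le r0 R0) => //; rewrite zE ltW.
  by apply: lt_trans (_ : tau * v x1 < _); rewrite ?mulr_gt0 ?v0// -subr_gt0.
(* The penalty then never exceeds [delta * rho^2 = u z], the value of [u] on the outer sphere. *)
pose delta := u z / rho ^+ 2.
have delta0 : 0 < delta by rewrite divr_gt0// exprn_gt0.
have Bx1' : r0 <= enorm x1 <= rho by rewrite Bx1.1 ltW.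
have [|||y [x [M [[ry yx xrho] gM gE Hmax]]]] :=
    annulus_pair_max r0 rho delta g w x1 Bx1'.
- move=> x /Bcl Bx; apply: (continuousB (C2_continuous _ _ _ _ uC2 Bx)).
  apply: (continuousM _ (C2_continuous _ _ _ _ vC2 Bx)).
  by move=> ?; exact: cst_continuous.
- by move=> x /Bcl Bx; exact: (C2_continuous _ _ _ _ wC2 Bx).
- by move=> x /Bcl /w0.
have M0 : 0 < M by rewrite (lt_le_trans _ gM)// divr_gt0// w0.
have rx : r0 <= enorm x by exact: le_trans yx.
have Bcx : Bclosed r0 R0 x by apply: Bcl; rewrite rx.
have Bcy : Bclosed r0 R0 y by apply: Bcl; rewrite ry (le_trans yx).
have wx := w0 _ Bcx.
have xltrho : enorm x < rho.
  (* On the outer sphere [M w x = g y + penalty <= u x + u x], since [g y <= u y <= u x]; hence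
     [u x / w x >= M / 2], above the threshold. *)
  rewrite lt_neqAle xrho andbT; apply/eqP => xE.
  have uxz : u x = u z by rewrite (radial_eq _ _ _ _ _ radu Bz)// zE.
  have := uw x; rewrite /Bopen/= xE => /(_ (conj rho0rho rhoR)).
  rewrite ltr_pdivrMr// ltNge => /negP; apply.
  rewrite mulrAC ler_pdivrMr//.
  apply: (@le_trans _ _ (M * w x)); first by rewrite ler_pM2r.
  rewrite -gE mulr_natr mulr2n lerD//.
    rewrite /g lerBlDr ler_wpDr//; first by rewrite mulr_ge0 ?ltW// v0.
    exact: (mono_inc_le r0 R0).
  apply: (@le_trans _ _ (delta * rho ^+ 2)).
    by rewrite ler_pM2l// xE gerBl sqr_ge0.
  by rewrite divfK ?uxz// expf_neq0// gt_eqF.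
have rltx : r0 < enorm x.
  (* On the inner sphere [y] lies there too, so [M w x = g y < 0], which is absurd. *)
  rewrite lt_neqAle rx andbT; apply/eqP => xE.
  have yE : enorm y = r0 by apply/eqP; rewrite eq_le ry xE yx.
  have := mulr_gt0 M0 wx; rewrite -gE -xE yE subrr mulr0 addr0.
  by move/(lt_trans (gr0 _ yE)); rewrite ltxx.
have Box : Bopen r0 R0 x by split; last exact: Bcx.2.
have x0 : 0 < enorm x by exact: lt_trans rltx.
have [nw ddw] := C2_at _ _ _ _ wC2 Bcx.
have near_lt : \forall x' \near x, enorm x' < rho.
  exact: (cvgr_lt _ (enorm_continuous x)).
(* If [|y| < |x|], then [y] can be frozen while [x] varies, and maximality becomes contact with a
   paraboloid. *)
move: yx; rewrite le_eqVlt => /predU1P[yxE|ltyx]; last first.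
  have near_gt : \forall x' \near x, enorm y < enorm x'.
    exact: (cvgr_gt _ (enorm_continuous x)).
  apply: (no_touching_paraboloid V w x p
    (g y - delta * enorm y ^+ 2) delta M) => //.
  - exact: V0.
  - by rewrite -gE mulrBr; ring.
  - near=> x'; have := Hmax y x' ry; rewrite mulrBr addrCA addrC.
    by apply; rewrite ltW//; near: x'.
  - exact: Lw.
have gyx : g y = g x.
  rewrite /g (radial_eq _ _ _ _ _ radu Bcx yxE).
  by rewrite (radial_eq _ _ _ _ _ radv Bcx yxE).
rewrite yxE subrr mulr0 addr0 gyx in gE.
have [nu ddu] := C2_at _ _ _ _ uC2 Bcx; have [nv ddv] := C2_at _ _ _ _ vC2 Bcx.
have du := nbhs_singleton nu; have dv := nbhs_singleton nv.
have slope : 2 * delta * enorm x <= rad_deriv u x - tau * rad_deriv v x.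
  apply: (max_slope r0 R0) => // y' ry' yx'; rewrite -/(g y') -/(g x) gE.
  exact: Hmax.
apply: (no_touching_difference V u v w x p tau M) => //.
- exact: V0.
- exact: v0.
- by rewrite -gE addrC subrK.
- have nB := near_Bopen _ _ _ Box.
  (* Diagonal pairs [(x', x')] carry no penalty, so maximality reads [g <= M w] near [x]. *)
  near=> x'; rewrite -lerBlDl -/(g x').
  have [/ltW rx' _] : Bopen r0 R0 x' by near: x'.
  have /ltW x'rho : enorm x' < rho by near: x'.
  have := Hmax x' x' rx' (lexx _) x'rho.
  by rewrite subrr mulr0 addr0.
- by move=> i; exact: (radial_partial r0 R0).
- by move=> i; exact: (radial_partial r0 R0).
- exact: monov.
- by rewrite -subr_gt0; apply: lt_le_trans slope; rewrite mulr_gt0// mulr_gt0.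
- exact: Lu.
- exact: Lv.
- exact: Lw.
Unshelve. all: by end_near. Qed.

End Comparison.

(** * The dichotomy *)

Theorem theorem3p10 (R : realType) (N : nat) (p r0 : R) (R0 : \bar R)
    (V u : 'rV[R]_N -> R) :
  (2 <= N)%N -> 2 <= p -> 0 < r0 -> (r0%:E < R0)%E ->
  (forall x, Bopen r0 R0 x -> {for x, continuous V}) ->
  (forall x, Bopen r0 R0 x -> 0 <= V x) ->
  (exists w0 : 'rV[R]_N -> R,
     [/\ positive r0 R0 w0, radial r0 R0 w0, strict_mono_inc r0 R0 w0
       & strict_supersolution p V r0 R0 w0]) ->
  radial r0 R0 u -> mono_inc r0 R0 u -> subsolution p V r0 R0 u ->
  (forall x, enorm x = r0 -> 0 <= u x) ->
  (forall v : 'rV[R]_N -> R,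
     positive r0 R0 v -> radial r0 R0 v -> strict_mono_inc r0 R0 v ->
     strict_supersolution p V r0 R0 v ->
     exists C : R, 0 < C /\ forall x, Bclosed r0 R0 x -> u x <= C * v x)
  \/
  (forall w : 'rV[R]_N -> R,
     positive r0 R0 w -> supersolution p V r0 R0 w ->
     (0 < limsup_R0 r0 R0 (fun x => (u x / w x)%R))%E).
Proof.
move=> N2 p2 r00 r0R _ V0 _ radu monou subu _.
have [ii|nii] := pselect (forall w : 'rV[R]_N -> R,
     positive r0 R0 w -> supersolution p V r0 R0 w ->
     (0 < limsup_R0 r0 R0 (fun x => (u x / w x)%R))%E); [by right|left].
(* A single [w] violating (ii) yields the bound of (i) for each [v]. *)
move=> v v0 radv monov supv; apply: contrapT => noC; apply: nii => w w0 supw.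
apply: contrapT => lim; apply: noC.
by apply: (subsolution_le_mul V u v w p r0 R0) => //; exact: ltnW.
Qed.
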